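(* For every $r>1$, let $d=\frac12(r+1)$ and let $S_r$ be the operator on $\mathbb{C}\oplus\mathbb{C}\oplus L^2[1,d]\oplus L^2[1,d]$ defined by $$S_r=2(1-d)\oplus0\oplus\begin{pmatrix}D_0-(2d-1)I_0&(D_0-I_0)^{\frac12}(dI_0-D_0)^{\frac12}\\0&(2d-1)(D_0-I_0)\end{pmatrix},$$ where $I_0$ is the identity on $L^2[1,d]$ and $(D_0g)(t)=tg(t)$ for $g\in L^2[1,d]$. Then $\overline{W(S_r)}$ is not an elliptical disk.
   Context: The numerical range of an operator $T$ on a Hilbert space is $W(T)=\{\langle Tx,x\rangle:\|x\|=1\}$, and $\overline{E}$ is the closure of $E\subseteq\mathbb{C}$. An elliptical disk is a closed region in $\mathbb{C}$ bounded by an ellipse, degenerate cases (line segments and points) being allowed, as in the elliptical range theorem. In the paper $S_r$ is defined as an element of the $C^*$-algebra $C^*\{Q_r\}\subseteq\mathbb{C}\oplus\{0\}\oplus M_2(C[1,d])$ generated by the idempotent $Q_r=1\oplus0\oplus\begin{pmatrix}D_0&-\ell(D_0)\\\ell(D_0)&I_0-D_0\end{pmatrix}$ with $I_0(t)=1$, $D_0(t)=t$, $\ell(D_0)(t)=\sqrt{t(t-1)}$ in $C[1,d]$; each $f\in C[1,d]$ is identified with multiplication by $f$ on $L^2[1,d]$ (Lebesgue measure), and the second summand $0$ is the zero operator on the second copy of $\mathbb{C}$. *)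

(* Defs.v *)
From HB Require Import structures.
From mathcomp Require Import all_boot all_order all_algebra.
From mathcomp Require Import complex.
From mathcomp Require Import all_classical all_reals all_analysis.
From mathcomp Require Import measurable_realfun.

Set Implicit Arguments.
Unset Strict Implicit.
Unset Printing Implicit Defensive.

Import Order.TTheory GRing.Theory Num.Theory.
Import numFieldNormedType.Exports.
Import ComplexField.Normc.

Local Open Scope classical_set_scope.
Local Open Scope ring_scope.
Local Open Scope complex_scope.

Section NumericalRange.
Context {R : realType} {H : Type}.
Variable ip : H -> H -> R[i].

Definition hnorm (x : H) : R := Num.sqrt (complex.Re (ip x x)).

Definition numerical_range (T : H -> H) : set R[i] :=
  [set ip (T x) x | x in [set x | hnorm x = 1]].
End NumericalRange.

(* The region bounded by the ellipse with foci [f1], [f2] and major axis [s];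
   it is a segment when [s] is the distance of the foci, a point if moreover
   [f1 = f2]. [normc] is the real-valued modulus. *)
Definition elliptical_disk {R : realType} (E : set R[i]) : Prop :=
  exists (f1 f2 : R[i]) (s : R),
    normc (f1 - f2) <= s /\ E = [set z | normc (z - f1) + normc (z - f2) <= s].

(* Closure for the topology induced by the modulus. *)
Definition closure_Ri {R : realType} (E : set R[i]) : set R[i] :=
  closure (E : set (R[i] : numFieldType)).

Section L2Class.
Context {R : realType} d {T : measurableType d}.
Variable mu : {measure set T -> \bar R}.

Lemma Lfun2_ae (f g : T -> R) : measurable_fun setT f ->
  g \in Lfun mu 2%:E -> f = g %[ae mu] -> f \in Lfun mu 2%:E.
Proof.
move=> mf /andP[]; rewrite !inE /= => mg fing fg.
apply/andP; split; rewrite inE//=; move: fing; rewrite /finite_norm.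
suff -> : ('N[mu]_2%:E[EFin \o f] = 'N[mu]_2%:E[EFin \o g])%E by [].

rewrite unlock; congr (poweR _ _); apply: ae_eq_integral => //.
- apply: (measurableT_comp (measurable_poweR _)) => //.
  by do 2 apply: measurableT_comp => //.
- apply: (measurableT_comp (measurable_poweR _)) => //.
  by do 2 apply: measurableT_comp => //.
- by apply: filterS fg => x /= fgx _; rewrite fgx.
Qed.


Lemma Lfun2_measurable (f : T -> R) : f \in Lfun mu 2%:E ->
  measurable_fun setT (f : T -> measurableTypeR R).
Proof. by move=> /andP[]; rewrite inE. Qed.

Definition Lfun2_mfun (f : T -> R) (Lf : f \in Lfun mu 2%:E) :
    {mfun T >-> measurableTypeR R} :=
  MeasurableFun.Pack (MeasurableFun.Class
    (isMeasurableFun.Build _ _ T (measurableTypeR R) f (Lfun2_measurable Lf))).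

Definition ae_class (f : T -> R) (Lf : f \in Lfun mu 2%:E) :
    {mfun_ mu, T >-> measurableTypeR R} :=
  (\pi_{mfun_ mu, T >-> measurableTypeR R} (Lfun2_mfun Lf))%qT.

Lemma ae_classE (f : T -> R) (Lf : f \in Lfun mu 2%:E) :
  (ae_class Lf : T -> R) = f %[ae mu].
Proof.
have : (repr (ae_class Lf) = Lfun2_mfun Lf %[mod {mfun_ mu, T >-> measurableTypeR R}])%qT.
  by rewrite reprK.
by move/eqP; rewrite eqmodE => /asboolP.
Qed.

Lemma ae_class_finite (f : T -> R) (Lf : f \in Lfun mu 2%:E) :
  finite_norm mu 2%:E (ae_class Lf).
Proof.
have mc : measurable_fun setT (ae_class Lf : T -> R).
  exact: (@measurable_funPT _ _ _ _ (repr (ae_class Lf))).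
by have /andP[_] := Lfun2_ae mc Lf (ae_classE Lf); rewrite inE.
Qed.

Definition L2_class (f : T -> R) (Lf : f \in Lfun mu 2%:E) : LspaceType2 mu :=
  LebesgueSpace.Pack (LebesgueSpace.Class
    (isFinLebesgue.Axioms_ _ _ _ _ (lee1n 2) _ (ae_class_finite Lf))).

Lemma L2_Lfun (f : LspaceType2 mu) : (f : T -> R) \in Lfun mu 2%:E.
Proof.
apply/andP; split; rewrite inE /=; last exact: Lebesgue_finite.
exact: (@measurable_funPT _ _ _ _ (repr (f : {mfun_ mu, T >-> measurableTypeR R}))).
Qed.


Definition L2_add (f g : LspaceType2 mu) : LspaceType2 mu :=
  L2_class ((Lfun_addr_closed mu (lee1n 2)).2 _ _ (L2_Lfun f) (L2_Lfun g)).

Lemma Lfun2_le (f g : T -> R) : measurable_fun setT f ->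
  (forall x, `|f x| <= `|g x|) -> g \in Lfun mu 2%:E -> f \in Lfun mu 2%:E.
Proof.
move=> mf fg /andP[]; rewrite !inE /= => mg fing.
apply/andP; split; rewrite inE//=; move: fing; rewrite /finite_norm.
apply: le_lt_trans; rewrite unlock gt0_ler_poweR//.
- by rewrite in_itv/= leey integral_ge0// => x _; exact: poweR_ge0.
- by rewrite in_itv/= leey integral_ge0// => x _; exact: poweR_ge0.
apply: ge0_le_integral => //.
- by move=> x _; exact: poweR_ge0.
- apply: (measurableT_comp (measurable_poweR _)) => //.
  by do 2 apply: measurableT_comp => //.
- apply: (measurableT_comp (measurable_poweR _)) => //.
  by do 2 apply: measurableT_comp => //.
- by move=> x _; rewrite /= lee_fin ge0_ler_powR ?nnegrE.
Qed.

End L2Class.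

Section MultiplicationOperators.
Context {R : realType} (d : R).

(* Lebesgue measure carried by [1, d]. *)
Definition leb1d : {measure set (measurableTypeR R) -> \bar R} :=
  mrestr lebesgue_measure (measurable_itv `[1, d]).

Lemma mul_Lfun2 (phi : R -> R) (f : LspaceType2 leb1d) :
  {within `[1, d], continuous phi} ->
  (phi \_ `[1, d]) \* (f : R -> R) \in Lfun leb1d 2%:E.
Proof.
move=> cphi.
have [M phiM] : exists M, forall t, `|(phi \_ `[1, d]) t| <= M.
  have [d1|d1] := leP 1 d; last first.
    exists 0 => t; rewrite patchE; case: ifPn => [|_]; last by rewrite normr0.
    rewrite inE /= in_itv /= => /andP[t1 td].
    by have := le_lt_trans (le_trans t1 td) d1; rewrite ltxx.
  have cn : {within `[1, d], continuous (fun t => `|phi t|)}.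
    by move=> t; apply: continuous_comp; [exact: cphi|exact: norm_continuous].
  have [c _ cM] := EVT_max d1 cn; exists `|phi c| => t.
  by rewrite patchE; case: ifPn => [|_]; rewrite ?normr0// inE => /cM.
have mphi : measurable_fun setT (phi \_ `[1, d] : R -> R).
  apply/(measurable_restrictT phi (measurable_itv `[1, d])).
  exact: subspace_continuous_measurable_fun (measurable_itv _) cphi.
have Lf := L2_Lfun f.
have M0 : 0 <= M by exact: le_trans (phiM 0).
have LMf : M \o* (f : R -> R) \in Lfun leb1d 2%:E.
  by apply: Lfun_scale => //; exact: ler1n.
apply: (Lfun2_le _ _ LMf).
- apply: measurable_funM => //; exact: Lfun2_measurable Lf.
- by move=> t; rewrite /= !normrM mulrC ler_wpM2l// (ger0_norm M0).
Qed.
End MultiplicationOperators.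

Section L2Interval.
Context {R : realType} (d : R).

(* The complex [L^2[1, d]]: classes [u +i* v] with [u] and [v] in the real
   [L^2[1, d]] of the library. *)
Definition L2C := (LspaceType2 (leb1d d))[i].

(* A representative function; it is determined almost everywhere. *)
Definition L2C_fun (f : L2C) (t : R) : R[i] :=
  (complex.Re f : R -> R) t +i* (complex.Im f : R -> R) t.

Definition L2C_ip (f g : L2C) : R[i] :=
  (\int[leb1d d]_t complex.Re (L2C_fun f t * (L2C_fun g t)^*))%R +i*
  (\int[leb1d d]_t complex.Im (L2C_fun f t * (L2C_fun g t)^*))%R.

Definition L2C_add (f g : L2C) : L2C :=
  L2_add (complex.Re f) (complex.Re g) +i* L2_add (complex.Im f) (complex.Im g).

(* Multiplication by a real function of [C[1, d]]; it acts separately on real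
   and imaginary parts. Values of [phi] outside [1, d] are irrelevant. *)
Definition L2C_mul (phi : R -> R) (cphi : {within `[1, d], continuous phi})
    (f : L2C) : L2C :=
  L2_class (mul_Lfun2 (complex.Re f) cphi) +i*
  L2_class (mul_Lfun2 (complex.Im f) cphi).

(* The Hilbert space C + C + L^2[1, d] + L^2[1, d] (orthogonal direct sum). *)
Definition dsum : Type := R[i] * R[i] * L2C * L2C.

Definition dsum_ip (x y : dsum) : R[i] :=
  let: (x1, x2, f1, f2) := x in
  let: (y1, y2, g1, g2) := y in
  x1 * y1^* + x2 * y2^* + L2C_ip f1 g1 + L2C_ip f2 g2.

(* Elements of [C[1, d]], identified with their multiplication operators; the
   square roots are those of the C*-algebra [C[1, d]], hence pointwise. *)
Definition I0 : R -> R := cst 1.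
Definition D0 : R -> R := id.

Definition entry11 : R -> R := fun t => D0 t - (2 * d - 1) * I0 t.
Definition entry12 : R -> R :=
  fun t => Num.sqrt (D0 t - I0 t) * Num.sqrt (d * I0 t - D0 t).
Definition entry22 : R -> R := fun t => (2 * d - 1) * (D0 t - I0 t).

Lemma D0_continuous : continuous D0.
Proof. by move=> t; exact: cvg_id. Qed.

Lemma I0_continuous : continuous I0.
Proof. by move=> t; exact: cvg_cst. Qed.

Lemma ZI0_continuous (c : R) : continuous (fun t => c * I0 t).
Proof. by move=> t; apply: cvgM; [exact: cvg_cst|exact: I0_continuous]. Qed.

Lemma entry11_continuous : {within `[1, d], continuous entry11}.
Proof.
apply: continuous_subspaceT => t.
by apply: cvgB; [exact: D0_continuous|exact: ZI0_continuous].
Qed.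

Lemma entry12_continuous : {within `[1, d], continuous entry12}.
Proof.
apply: continuous_subspaceT => t; apply: cvgM.
- apply: (@continuous_comp _ _ _ (fun t => D0 t - I0 t) Num.sqrt).
    by apply: cvgB; [exact: D0_continuous|exact: I0_continuous].
  exact: sqrt_continuous.
- apply: (@continuous_comp _ _ _ (fun t => d * I0 t - D0 t) Num.sqrt).
    by apply: cvgB; [exact: ZI0_continuous|exact: D0_continuous].
  exact: sqrt_continuous.
Qed.

Lemma entry22_continuous : {within `[1, d], continuous entry22}.
Proof.
apply: continuous_subspaceT => t; apply: cvgM; first exact: cvg_cst.
by apply: cvgB; [exact: D0_continuous|exact: I0_continuous].
Qed.

(* The block on the last two summands is the upper triangular operator matrix
   with diagonal [entry11], [entry22] and upper right corner [entry12]. *)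
Definition S_op (x : dsum) : dsum :=
  let: (a, b, g, h) := x in
  ((2 * (1 - d))%:C * a, 0 * b,
   L2C_add (L2C_mul entry11_continuous g) (L2C_mul entry12_continuous h),
   L2C_mul entry22_continuous h).

End L2Interval.

(* Main.v *)
Require Import Defs.
From mathcomp Require Import all_boot all_order all_algebra.
From mathcomp Require Import complex.
From mathcomp Require Import all_classical all_reals all_analysis.
From mathcomp Require Import measurable_realfun ring lra.

Import Order.TTheory GRing.Theory Num.Theory.
Import numFieldNormedType.Exports.
Import ComplexField.Normc.
Local Open Scope classical_set_scope.
Local Open Scope ring_scope.
Local Open Scope complex_scope.

(* The real point p = (2d - 1)(d - 1), the value at t = d of the lower diagonal
   entry, is a corner of the closure of W(S_r). Pointwise in t, completing the
   square bounds Re z + |Im z| by p for every z in W(S_r), because the square of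
   the off-diagonal entry vanishes linearly at t = d, as does the gap between p
   and the lower diagonal entry; and p is approached by normalised indicators
   of small intervals [d - w, d] in the last summand. An elliptical disk with a
   corner is a segment or a point, whereas W(S_r) contains 0, 2(1 - d) and a
   nonreal number. *)

(** * Euclidean plane: focal distances and corners of ellipses *)

Section Plane.
Context {R : realType}.
Implicit Types x y u v w p s e : R.

Definition norm2 x y : R := Num.sqrt (x ^+ 2 + y ^+ 2).

Lemma norm2_ge0 x y : 0 <= norm2 x y.
Proof. exact: sqrtr_ge0. Qed.

Lemma norm2_sqr x y : norm2 x y ^+ 2 = x ^+ 2 + y ^+ 2.
Proof. by rewrite sqr_sqrtr// addr_ge0// sqr_ge0. Qed.

Lemma norm2_le x y s : 0 <= s -> x ^+ 2 + y ^+ 2 <= s ^+ 2 -> norm2 x y <= s.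
Proof. by move=> s0 h; rewrite -(@ler_pXn2r _ 2)// ?nnegrE ?norm2_ge0// norm2_sqr. Qed.

Lemma norm2_eq0 x y : norm2 x y <= 0 -> x = 0 /\ y = 0.
Proof.
move=> h; have /eqP h0 : norm2 x y == 0 by rewrite eq_le h norm2_ge0.
have := norm2_sqr x y; rewrite h0 expr0n /= => /esym/eqP.
by rewrite paddr_eq0 ?sqr_ge0// !sqrf_eq0 => /andP[/eqP -> /eqP ->].
Qed.

Lemma norm2_shift u v e : 0 <= e -> norm2 (u + e) v <= norm2 u v + e.
Proof.
move=> e0; have n0 := norm2_ge0 u v; have ns := norm2_sqr u v.
apply: norm2_le; first exact: addr_ge0.
have un : u <= norm2 u v by nra.
rewrite [leRHS]sqrrD ns; nra.
Qed.

(** First-order expansion of the norm with an explicit quadratic remainder, which avoids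
    derivatives. With n the norm at [(u, v)] and m the norm of the displaced vector, the right-hand
    side equals (n^2 + m^2) / (2n), so the bound amounts to (m - n)^2 >= 0. *)
Lemma norm2_expand u v wx wy e : 0 < norm2 u v ->
  norm2 (u + e * wx) (v + e * wy) <=
  norm2 u v + e * (u * wx + v * wy) / norm2 u v
            + e ^+ 2 * (wx ^+ 2 + wy ^+ 2) / (2 * norm2 u v).
Proof.
have ns := norm2_sqr u v; set n := norm2 u v in ns * => n0.
set m := norm2 _ _.
have ms : m ^+ 2 = (u + e * wx) ^+ 2 + (v + e * wy) ^+ 2 by exact: norm2_sqr.
have -> : n + e * (u * wx + v * wy) / n + e ^+ 2 * (wx ^+ 2 + wy ^+ 2) / (2 * n)
  = (n ^+ 2 + m ^+ 2) / (2 * n).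
  have : m ^+ 2 = n ^+ 2 + 2 * e * (u * wx + v * wy) + e ^+ 2 * (wx ^+ 2 + wy ^+ 2).
    by rewrite ms ns; ring.
  by move=> ->; field; rewrite gt_eqF.
rewrite ler_pdivlMr ?mulr_gt0//; have := sqr_ge0 (m - n); nra.
Qed.

(** Squaring the hypothesis gives |u||v| <= u.v. By the Lagrange identity (|u||v|)^2 is (u.v)^2 plus
    the square of the cross product, so the latter vanishes. *)
Lemma norm2_triangle_eq ux uy vx vy :
  norm2 ux uy + norm2 vx vy <= norm2 (ux + vx) (uy + vy) -> ux * vy = uy * vx.
Proof.
have := norm2_sqr ux uy; have := norm2_sqr vx vy.
have := norm2_sqr (ux + vx) (uy + vy).
have := norm2_ge0 ux uy; have := norm2_ge0 vx vy.
have := norm2_ge0 (ux + vx) (uy + vy).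
move: (norm2 ux uy) (norm2 vx vy) (norm2 _ _) => a b m m0 b0 a0 ms bs as_ h.
have h1 : a * b <= ux * vx + uy * vy.
  have : (a + b) ^+ 2 <= m ^+ 2 by rewrite ler_pXn2r// nnegrE// addr_ge0.
  by rewrite ms; nra.
have h2 : (a * b) ^+ 2 <= (ux * vx + uy * vy) ^+ 2.
  by rewrite ler_pXn2r// nnegrE ?(le_trans _ h1)// mulr_ge0.
apply/eqP; rewrite -subr_eq0 -sqrf_eq0 eq_le sqr_ge0 andbT.
rewrite exprMn as_ bs in h2.
by rewrite -(lerD2l ((ux * vx + uy * vy) ^+ 2)) addr0; apply: le_trans h2; lra.
Qed.

(* A boundary point p of a nondegenerate ellipse that is not a focus has a half
   plane of directions pointing into the ellipse; such a half plane is not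
   contained in the cone x + |y| <= 0. *)
Lemma ellipse_no_corner x1 y1 x2 y2 s p :
  norm2 (p - x1) (- y1) + norm2 (p - x2) (- y2) <= s ->
  (forall x y, norm2 (x - x1) (y - y1) + norm2 (x - x2) (y - y2) <= s ->
     x + `|y| <= p) ->
  s <= norm2 (x1 - x2) (y1 - y2).
Proof.
move=> ps cone; rewrite leNgt; apply/negP => fs.
(* With strict inequality, p could be moved to the right by half the slack, each focal distance
   growing by at most that much, and would leave the cone. *)
have eqs : norm2 (p - x1) (- y1) + norm2 (p - x2) (- y2) = s.
  apply/eqP; rewrite eq_le ps /= leNgt; apply/negP => lts.
  pose e := (s - (norm2 (p - x1) (- y1) + norm2 (p - x2) (- y2))) / 2.
  have e0 : 0 < e by rewrite /e; lra.
  have /cone : norm2 (p + e - x1) (0 - y1) + norm2 (p + e - x2) (0 - y2) <= s.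
    rewrite !sub0r !(addrAC p e).
    have := norm2_shift (p - x1) (- y1) e (ltW e0).
    have := norm2_shift (p - x2) (- y2) e (ltW e0).
    by rewrite /e; lra.
  by rewrite normr0; lra.
have N0 x y : 0 < norm2 x y \/ x = 0 /\ y = 0.
  by have [/norm2_eq0|] := leP (norm2 x y) 0; [right|left].
have norm00 : norm2 0 0 = 0 by rewrite /norm2 expr0n addr0 sqrtr0.
(* If p is a focus, then s is the focal distance, against [fs]; hence both focal distances of p are
   positive. *)
have [u0|[ux0 uy0]] := N0 (p - x1) (- y1); last first.
  have x1p : x1 = p by apply/esym/subr0_eq.
  have y10 : y1 = 0 by rewrite -[LHS]opprK uy0 oppr0.
  by move: eqs fs; rewrite ux0 uy0 norm00 add0r x1p y10 sub0r => ->; rewrite ltxx.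
have [v0|[vx0 vy0]] := N0 (p - x2) (- y2); last first.
  have x2p : x2 = p by apply/esym/subr0_eq.
  move: eqs fs; rewrite vx0 vy0 norm00 !addr0 x2p => <-.
  by rewrite /norm2 sqrrN -(sqrrN (p - x1)) opprB ltxx.
set a := norm2 _ _ in eqs u0; set b := norm2 _ _ in eqs v0.
(* [(gx, gy)] is the gradient at p of the sum of the focal distances. By [nodir], no direction
   leaving the cone decreases this sum to first order. *)
pose gx := (p - x1) / a + (p - x2) / b.
pose gy := (- y1) / a + (- y2) / b.
have nodir wx wy : 0 < wx + `|wy| -> 0 <= wx * gx + wy * gy.
  move=> wc; rewrite leNgt; apply/negP => wg.
  have w0 : 0 < wx ^+ 2 + wy ^+ 2.
    rewrite lt_def addr_ge0 ?sqr_ge0// andbT paddr_eq0 ?sqr_ge0// !sqrf_eq0.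
    apply/negP => /andP[/eqP wx0 /eqP wy0].
    by move: wc; rewrite wx0 wy0 normr0 addr0 ltxx.
  (* [K] is the coefficient of the quadratic remainder from [norm2_expand]; the step [e] makes the
     linear gain cancel it exactly. *)
  pose K := (wx ^+ 2 + wy ^+ 2) / (2 * a) + (wx ^+ 2 + wy ^+ 2) / (2 * b).
  have K0 : 0 < K by rewrite addr_gt0// divr_gt0// mulr_gt0.
  pose e := - (wx * gx + wy * gy) / K.
  have e0 : 0 < e by rewrite divr_gt0// oppr_gt0.
  have /cone : norm2 (p + e * wx - x1) (e * wy - y1)
             + norm2 (p + e * wx - x2) (e * wy - y2) <= s.
    rewrite !(addrAC p (e * wx)) !(addrC (e * wy)).
    apply: le_trans (lerD (norm2_expand (p - x1) (- y1) wx wy e u0)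
                          (norm2_expand (p - x2) (- y2) wx wy e v0)) _.
    rewrite -/a -/b -eqs.
    suff : e * (wx * gx + wy * gy) + e ^+ 2 * K = 0 by rewrite /gx /gy /K; lra.
    have -> : wx * gx + wy * gy = - (e * K) by rewrite /e mulfVK ?gt_eqF// opprK.
    by ring.
  rewrite normrM (gtr0_norm e0); have := mulr_gt0 e0 wc; nra.
(* The vertical directions both leave the cone, which gives gy = 0; then (1, 0) and (-1/2, 1) give
   the two signs of gx. *)
have gy0 : gy = 0.
  have := nodir 0 1; have := nodir 0 (- 1); rewrite normrN1 normr1; lra.
have gx0 : gx = 0.
  have := nodir 1 0; have := nodir (- 2^-1) 1; rewrite normr0 normr1 gy0; lra.
have ab : b != 0 by rewrite gt_eqF.
have aa : a != 0 by rewrite gt_eqF.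
(* A vanishing gradient makes the unit vectors from the foci to p opposite. So p lies between the
   foci and a + b = s is the focal distance, against [fs]. *)
have ux : p - x1 = - (a / b) * (p - x2).
  by move: gx0; rewrite /gx => /eqP; rewrite addr_eq0 => /eqP h; rewrite -[LHS](divfK aa) h; field.
have uy : y1 = - (a / b) * y2.
  move: gy0; rewrite /gy => /eqP; rewrite addr_eq0 => /eqP h.
  by rewrite -[LHS]opprK -[- y1](divfK aa) h; field.
have x12 : x1 - x2 = (1 + a / b) * (p - x2).
  by rewrite mulrDl mul1r -[a / b]opprK mulNr -ux; ring.
have y12 : y1 - y2 = (1 + a / b) * (- y2) by rewrite uy; ring.
move: fs; rewrite /norm2 x12 y12 !exprMn -mulrDr sqrtrM ?sqr_ge0//.
rewrite sqrtr_sqr ger0_norm; last by rewrite addr_ge0// divr_ge0// ltW.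
rewrite -[Num.sqrt _]/b -eqs mulrDl mul1r divfK// addrC ltxx //.
Qed.

End Plane.

(** * A closure with a corner and three noncollinear points is not an elliptical disk *)

Section Closure.
Context {R : realType}.
Implicit Types (z w : R[i]) (W : set R[i]).
Local Notation Re := complex.Re.
Local Notation Im := complex.Im.

Lemma normcB z w : normc (z - w) = norm2 (Re z - Re w) (Im z - Im w).
Proof. by case: z w => [? ?] [? ?]. Qed.

Lemma closure_RiP W z :
  closure_Ri W z <-> forall e : R, 0 < e -> exists2 w, W w & normc (z - w) < e.
Proof.
split=> [Wz e e0|Wz].
  have [|w [Ww zw]] := Wz (ball (z : (R[i] : numFieldType)) e%:C).
    by apply: nbhsx_ballx; rewrite ltcR.
  by exists w => //; rewrite -ltcR.
move=> B /nbhs_ballP[[e e'] /=].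
(* Radii of balls live in [R[i]]; positivity forces the imaginary part to be zero. *)
rewrite ltcE /= => /andP[/eqP -> e0] zB.
have [w Ww zw] := Wz _ e0; exists w; split=> //; apply: zB.
by rewrite /ball /= -ltcR in zw *.
Qed.

Lemma norm2_bounds x y : x <= norm2 x y :> R /\ `|y| <= norm2 x y.
Proof.
have ns := norm2_sqr x y; have n0 := norm2_ge0 x y.
by split; first nra; rewrite -(@ler_pXn2r _ 2)// ?nnegrE// real_normK ?num_real// ns; nra.
Qed.

(** The corner forces s to be at most the focal distance, so the disk is the focal segment. Its
    points are then collinear with the foci; as 0, q and z3 are not collinear, the foci coincide,
    and a single point cannot contain both 0 and q. *)
Lemma corner_not_elliptical W (p q : R) z3 :
  (forall z, W z -> Re z + `|Im z| <= p) -> closure_Ri W p%:C ->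
  W 0 -> W q%:C -> q != 0 -> W z3 -> Im z3 != 0 ->
  ~ elliptical_disk (closure_Ri W).
Proof.
move=> cone Wp W0 Wq q0 W3 z3R [[x1 y1] [[x2 y2] [s [fs WE]]]].
have EP x y : closure_Ri W (x +i* y) <->
    norm2 (x - x1) (y - y1) + norm2 (x - x2) (y - y2) <= s.
  by rewrite WE /mkset !normcB.
have subW z : W z -> closure_Ri W z by exact: subset_closure.
have ccone x y : closure_Ri W (x +i* y) -> x + `|y| <= p.
  move=> /closure_RiP zW; apply/ler_addgt0Pr => e e0.
  have [|w /cone] := zW (e / 2); first by rewrite divr_gt0.
  rewrite normcB /=; have [] := norm2_bounds (x - Re w) (y - Im w).
  move=> h1 h2 h3 h4; have := ler_normD (y - Im w) (Im w); rewrite subrK; lra.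
have ple : norm2 (p - x1) (- y1) + norm2 (p - x2) (- y2) <= s.
  by have := (EP p 0).1 Wp; rewrite !sub0r.
have sle := ellipse_no_corner x1 y1 x2 y2 s p ple
  (fun x y h => ccone x y ((EP x y).2 h)).
(* Equality in the triangle inequality for z - f1 and f2 - z, whose sum is f2 - f1. *)
have line x y : W (x +i* y) -> (x - x1) * (y2 - y) = (y - y1) * (x2 - x).
  move=> /subW/EP h; apply: norm2_triangle_eq.
  rewrite (_ : x - x1 + _ = x2 - x1); last by ring.
  rewrite (_ : y - y1 + _ = y2 - y1); last by ring.
  have sw (u v u' v' : R) : norm2 (u - u') (v - v') = norm2 (u' - u) (v' - v).
    by rewrite /norm2 -(sqrrN (u - u')) -(sqrrN (v - v')) !opprB.
  by rewrite (sw x2 y2 x y) (sw x2 y2 x1 y1); apply: le_trans sle.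
case: z3 W3 z3R => x3 y3 /line l3 /= y30.
have l0 := line _ _ W0; have lq := line _ _ Wq.
have y12 : y1 = y2.
  have : q * (y2 - y1) = 0 by lra.
  by move/eqP; rewrite mulf_eq0 (negPf q0) subr_eq0 => /eqP.
have x12 : x1 = x2.
  have : y3 * (x2 - x1) = 0 by move: l0 l3; rewrite y12; lra.
  by move/eqP; rewrite mulf_eq0 (negPf y30) subr_eq0 => /eqP.
have single x y : W (x +i* y) -> x = x1.
  move=> /subW/EP h; move: sle; rewrite x12 y12 !subrr.
  rewrite /norm2 expr0n addr0 sqrtr0 => s0.
  move: h; rewrite -x12 -y12 => h; have n0 := norm2_ge0 (x - x1) (y - y1).
  have /norm2_eq0[] : norm2 (x - x1) (y - y1) <= 0 by lra.
  by move/subr0_eq.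
by case/eqP: q0; rewrite (single _ _ Wq) -(single _ _ W0).
Qed.

End Closure.

(** * Integrals of functions known almost everywhere, and of indicators *)

Section L2.
Context {R : realType} {d} {T : measurableType d}.
Variable mu : {measure set T -> \bar R}.
Implicit Types f g : T -> R.

Lemma eq_Rintegral_ae f g : measurable_fun setT f -> measurable_fun setT g ->
  f = g %[ae mu] -> \int[mu]_t f t = \int[mu]_t g t.
Proof.
move=> mf mg fg; rewrite /Rintegral; congr fine; apply: ae_eq_integral => //.
- exact/measurable_EFinP.
- exact/measurable_EFinP.
- by apply: filterS fg => x /= fgx _; rewrite fgx.
Qed.

(** Four functions are replaced at once because a pairing of two complex classes involves the real
    and imaginary parts of both. *)
Lemma eq_Rintegral_ae4 (P : R -> R -> R -> R -> R) f1 f2 f3 f4 g1 g2 g3 g4 :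
  measurable_fun setT (fun t => P (f1 t) (f2 t) (f3 t) (f4 t)) ->
  measurable_fun setT (fun t => P (g1 t) (g2 t) (g3 t) (g4 t)) ->
  f1 = g1 %[ae mu] -> f2 = g2 %[ae mu] -> f3 = g3 %[ae mu] -> f4 = g4 %[ae mu] ->
  \int[mu]_t P (f1 t) (f2 t) (f3 t) (f4 t) = \int[mu]_t P (g1 t) (g2 t) (g3 t) (g4 t).
Proof.
move=> mf mg e1 e2 e3 e4; apply: eq_Rintegral_ae => //.
have e12 : {ae mu, forall t, f1 t = g1 t /\ f2 t = g2 t}.
  by apply: filterS2 e1 e2 => t h1 h2; rewrite h1// h2.
by apply: filterS3 e12 e3 e4 => t [h1 h2] h3 h4 _; rewrite h1 h2 h3// h4.
Qed.

Lemma indic_Lfun2 (A : set T) : measurable A -> (mu A < +oo)%E ->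
  \1_A \in Lfun mu 2%:E.
Proof.
move=> mA muA; apply/andP; split; rewrite inE //=.
rewrite /finite_norm unlock poweR_lty//.
rewrite (eq_integral (fun t => (\1_A t)%:E)) ?integral_indic ?setIT// => t _ /=.
congr EFin; rewrite indicE; case: (_ \in _) => /=.
  by rewrite normr1 powR1.
by rewrite normr0 powR0// pnatr_eq0.
Qed.

Lemma Lfun1D f g : f \in Lfun mu 1 -> g \in Lfun mu 1 ->
  (fun t => f t + g t) \in Lfun mu 1.
Proof. exact: (Lfun_addr_closed mu (lexx 1%E)).2. Qed.

Lemma Lfun1Z a f : f \in Lfun mu 1 -> (fun t => a * f t) \in Lfun mu 1.
Proof.
move=> Lf; rewrite (_ : (fun _ => _) = a \o* f); last first.
  by apply/funext => t /=; rewrite mulrC.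
exact: (@Lfun_scale _ _ _ mu f a 1 (lexx 1) Lf).
Qed.

Lemma Rintegral_Lfun1D f g : f \in Lfun mu 1 -> g \in Lfun mu 1 ->
  \int[mu]_t (f t + g t) = \int[mu]_t f t + \int[mu]_t g t.
Proof. by move=> /Lfun1_integrable ? /Lfun1_integrable ?; exact: RintegralD. Qed.

Lemma Rintegral_Lfun1Z a f : f \in Lfun mu 1 ->
  \int[mu]_t (a * f t) = a * \int[mu]_t f t.
Proof. by move=> /Lfun1_integrable ?; exact: RintegralZl. Qed.

Lemma Rintegral_indic (A : set T) : measurable A ->
  \int[mu]_t \1_A t = fine (mu A).
Proof. by move=> mA; rewrite /Rintegral integral_indic// setIT. Qed.

Lemma Rintegral_indic_ge (A : set T) m f :
  measurable A -> (mu A < +oo)%E -> f \* \1_A \in Lfun mu 1 ->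
  (forall t, A t -> m <= f t) -> m * fine (mu A) <= \int[mu]_t (f t * \1_A t).
Proof.
move=> mA muA /Lfun1_integrable fA mf.
(* An indicator is its own square, hence integrable as a product of two square-integrable
   functions. *)
have iA : mu.-integrable setT (EFin \o \1_A).
    have /Lfun1_integrable : \1_A \* \1_A \in Lfun mu 1.
      by apply: Lfun2_mul_Lfun1; exact: indic_Lfun2.
    congr (mu.-integrable _ _); apply/funext => t /=.
    by rewrite indicE; case: (_ \in _); rewrite ?mulr1 ?mulr0.
have -> : m * fine (mu A) = \int[mu]_t (m * \1_A t).
  rewrite RintegralZl//; congr (_ * _).
  exact/esym/Rintegral_indic.
apply: le_Rintegral => //.
  exact: (@integrableZl _ _ _ mu setT measurableT m (EFin \o \1_A)).
move=> t _; rewrite indicE; case: (boolP (t \in A)) => [/set_mem/mf|_].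
  by rewrite !mulr1.
by rewrite !mulr0.
Qed.

End L2.

(** * The quadratic form of S_r in terms of representatives *)

Section NumericalRangeSr.
Context {R : realType} (d : R).
Local Notation mu := (leb1d d).
Local Notation Re := complex.Re.
Local Notation Im := complex.Im.
Local Notation e11 := (entry11 d \_ `[1, d]).
Local Notation e12 := (entry12 d \_ `[1, d]).
Local Notation e22 := (entry22 d \_ `[1, d]).
Local Notation W := (numerical_range (@dsum_ip R d) (@S_op R d)).
Implicit Types (u v : L2C d) (f g phi : R -> R).

#[local] Instance leb1d_ae_filter : Filter (nbhs (almost_everywhere mu)).
Proof. exact: (ae_filter_ringOfSetsType mu). Qed.

(** Elements of [L2C] are quotient classes. This relation lets inner products and the action of
    [S_op] be computed by pointwise formulas on chosen functions. *)
Definition represents u f g :=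
  [/\ f \in Lfun mu 2%:E, g \in Lfun mu 2%:E,
      (Re u : R -> R) = f %[ae mu] & (Im u : R -> R) = g %[ae mu]].

Lemma represents_refl u : represents u (Re u : R -> R) (Im u : R -> R).
Proof. by split; [exact: L2_Lfun|exact: L2_Lfun|exact: aeW|exact: aeW]. Qed.

Lemma represents_class f g (Lf : f \in Lfun mu 2%:E) (Lg : g \in Lfun mu 2%:E) :
  represents (L2_class Lf +i* L2_class Lg) f g.
Proof. by split=> //; exact: ae_classE. Qed.

Lemma represents_add u v f g f' g' : represents u f g -> represents v f' g' ->
  represents (L2C_add u v) (f \+ f') (g \+ g').
Proof.
move=> [Lf Lg uf ug] [Lf' Lg' vf vg].
split; [exact: (Lfun_addr_closed mu (lee1n 2)).2
       |exact: (Lfun_addr_closed mu (lee1n 2)).2| |].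
- have := ae_classE ((Lfun_addr_closed mu (lee1n 2)).2 _ _
                      (L2_Lfun (Re u)) (L2_Lfun (Re v))).
  apply: filterS3 uf vf => t h1 h2 h3 _.
  by rewrite (h3 I) [RHS]/= -(h1 I) -(h2 I).
- have := ae_classE ((Lfun_addr_closed mu (lee1n 2)).2 _ _
                      (L2_Lfun (Im u)) (L2_Lfun (Im v))).
  apply: filterS3 ug vg => t h1 h2 h3 _.
  by rewrite (h3 I) [RHS]/= -(h1 I) -(h2 I).
Qed.

Lemma represents_mul u phi (cphi : {within `[1, d], continuous phi}) f g :
  represents u f g ->
  represents (L2C_mul cphi u) ((phi \_ `[1, d]) \* f) ((phi \_ `[1, d]) \* g).
Proof.
have mulL (w : LspaceType2 mu) h : h \in Lfun mu 2%:E ->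
    (w : R -> R) = h %[ae mu] ->
    (phi \_ `[1, d]) \* h \in Lfun mu 2%:E /\
    (L2_class (mul_Lfun2 w cphi) : R -> R) = (phi \_ `[1, d]) \* h %[ae mu].
  move=> Lh wh.
  (* [mul_Lfun2] speaks of classes only, so it is applied to the class of [h] and transferred to [h]
     itself almost everywhere. *)
  have Lm := mul_Lfun2 (L2_class Lh) cphi.
  have e := ae_classE Lh.
  have m : measurable_fun setT ((phi \_ `[1, d]) \* h).
    apply: measurable_funM (Lfun2_measurable Lh).
    apply/(measurable_restrictT phi (measurable_itv `[1, d])).
    exact: subspace_continuous_measurable_fun (measurable_itv _) cphi.
  split.
    apply: (@Lfun2_ae _ _ _ mu _ _ m Lm).
    by apply: filterS e => t /= h1 _; rewrite (h1 I).
  have := ae_classE (mul_Lfun2 w cphi).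
  by apply: filterS2 wh => t h1 h2 _; rewrite (h2 I) /= (h1 I).
by move=> [Lf Lg /(mulL _ _ Lf)[? ?] /(mulL _ _ Lg)[? ?]].
Qed.

Lemma L2C_ip_represents u v f g f' g' :
  represents u f g -> represents v f' g' ->
  L2C_ip u v = (\int[mu]_t (f t * f' t + g t * g' t)) +i*
               (\int[mu]_t (g t * f' t - f t * g' t)).
Proof.
move=> [Lf Lg uf ug] [Lf' Lg' vf vg].
have mf := Lfun2_measurable Lf; have mg := Lfun2_measurable Lg.
have mf' := Lfun2_measurable Lf'; have mg' := Lfun2_measurable Lg'.
have mru := Lfun2_measurable (L2_Lfun (Re u)).
have miu := Lfun2_measurable (L2_Lfun (Im u)).
have mrv := Lfun2_measurable (L2_Lfun (Re v)).
have miv := Lfun2_measurable (L2_Lfun (Im v)).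
rewrite /L2C_ip; congr (_ +i* _).
  rewrite -(eq_Rintegral_ae4 mu (fun a b a' b' => a * a' + b * b') _ _ _ _ _ _ _ _
    _ _ uf ug vf vg).
  - by apply: eq_Rintegral => t _ /=; ring.
  - by apply: measurable_funD; exact: measurable_funM.
  - by apply: measurable_funD; exact: measurable_funM.
rewrite -(eq_Rintegral_ae4 mu (fun a b a' b' => b * a' - a * b') _ _ _ _ _ _ _ _
  _ _ uf ug vf vg).
- by apply: eq_Rintegral => t _ /=; ring.
- by apply: measurable_funB; exact: measurable_funM.
- by apply: measurable_funB; exact: measurable_funM.
Qed.

Lemma dsum_ip_represents (a b : R[i]) (g h : L2C d) (gr gi hr hi : R -> R) :
  represents g gr gi -> represents h hr hi ->
  Re (dsum_ip (a, b, g, h) (a, b, g, h)) =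
  (Re a ^+ 2 + Im a ^+ 2) + (Re b ^+ 2 + Im b ^+ 2) +
  \int[mu]_t (gr t * gr t + gi t * gi t) +
  \int[mu]_t (hr t * hr t + hi t * hi t).
Proof.
move=> rg rh; rewrite /dsum_ip.
rewrite (L2C_ip_represents _ _ _ _ _ _ rg rg).
rewrite (L2C_ip_represents _ _ _ _ _ _ rh rh).
by case: a b => [a1 a2] [b1 b2] /=; ring.
Qed.

Lemma S_op_represents (a b : R[i]) (g h : L2C d) (gr gi hr hi : R -> R) :
  represents g gr gi -> represents h hr hi ->
  dsum_ip (S_op (a, b, g, h)) (a, b, g, h) =
  (2 * (1 - d) * (Re a ^+ 2 + Im a ^+ 2) +
   \int[mu]_t ((e11 t * gr t + e12 t * hr t) * gr t +
               (e11 t * gi t + e12 t * hi t) * gi t) +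
   \int[mu]_t (e22 t * hr t * hr t + e22 t * hi t * hi t)) +i*
  \int[mu]_t ((e11 t * gi t + e12 t * hi t) * gr t -
              (e11 t * gr t + e12 t * hr t) * gi t).
Proof.
move=> rg rh; rewrite /dsum_ip /S_op.
rewrite (L2C_ip_represents _ _ _ _ _ _ (represents_add _ _ _ _ _ _
  (represents_mul _ _ (entry11_continuous (d:=d)) _ _ rg)
  (represents_mul _ _ (entry12_continuous (d:=d)) _ _ rh)) rg).
rewrite (L2C_ip_represents _ _ _ _ _ _
  (represents_mul _ _ (entry22_continuous (d:=d)) _ _ rh) rh) /=.
(* The lower diagonal multiplier is real, so it adds nothing to the imaginary part. *)
have -> : \int[mu]_t (e22 t * hi t * hr t - e22 t * hr t * hi t) = 0.
  rewrite (_ : (fun _ => _) = fun=> 0); last by apply/funext => t; ring.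
  by rewrite Rintegral_cst// mul0r.
by case: a b => [a1 a2] [b1 b2] /=; congr (_ +i* _); ring.
Qed.

(** * The cone containing the numerical range *)

Definition apex : R := (2 * d - 1) * (d - 1).
Local Notation p := apex.

Lemma apex_gt0 : 1 < d -> 0 < apex.
Proof. by move=> d1; apply: mulr_gt0; lra. Qed.

(* AM-GM: with G = |g|^2, H = |h|^2 and m the form multiplying q = entry12, one has
   m^2 <= 2 G H, and q^2 is dominated by the product of the diagonal gaps. *)
Lemma form_le s t (gr gi hr hi : R) : 1 < d -> s ^+ 2 = 1 ->
  ((e11 t * gr + e12 t * hr) * gr + (e11 t * gi + e12 t * hi) * gi) +
  (e22 t * hr * hr + e22 t * hi * hi) +
  s * ((e11 t * gi + e12 t * hi) * gr - (e11 t * gr + e12 t * hr) * gi) <=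
  p * (gr * gr + gi * gi) + p * (hr * hr + hi * hi).
Proof.
move=> d1; have p0 := apex_gt0 d1.
pose G := gr * gr + gi * gi; pose H := hr * hr + hi * hi.
have G0 : 0 <= G by rewrite addr_ge0// -expr2 sqr_ge0.
have H0 : 0 <= H by rewrite addr_ge0// -expr2 sqr_ge0.
pose m := gr * (hr + s * hi) + gi * (hi - s * hr).
move=> s1; have {s1} m2 : m ^+ 2 <= 2 * (G * H).
  have -> : 2 * (G * H) = G * ((1 + s ^+ 2) * H) by rewrite s1; ring.
  (* Cauchy-Schwarz: this square is the gap between G (1 + s^2) H and m^2. *)
  clear s1; have : 0 <= (gr * (hi - s * hr) - gi * (hr + s * hi)) ^+ 2.
    exact: sqr_ge0.
  by rewrite /m /G /H; lra.
(* Outside [1, d] the restricted entries take the default value 0, and the bound follows from p >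
   0. *)
rewrite !patchE; case: ifPn => [|_]; last first.
  have pG := mulr_ge0 (ltW p0) G0; have pH := mulr_ge0 (ltW p0) H0.
  by rewrite -/G -/H -[point]/(0 : R); lra.
rewrite inE /= in_itv /= => /andP[t1 td].
pose q := entry12 d t.
have q2 : q ^+ 2 = (t - 1) * (d - t).
  by rewrite exprMn !sqr_sqrtr /D0 /I0 /= ?mulr1// ; lra.
have qm : q * m <= (p - entry11 d t) * G + (p - entry22 d t) * H.
  have -> : p - entry11 d t = 2 * (d - 1) * d + (d - t).
    by rewrite /apex /entry11 /D0 /I0 /=; ring.
  have -> : p - entry22 d t = (2 * d - 1) * (d - t).
    by rewrite /apex /entry22 /D0 /I0 /=; ring.
  set u := d - t; have u0 : 0 <= u by rewrite /u; lra.
  have k0 : 0 <= (2 * (d - 1) * d + u) * G + (2 * d - 1) * u * H.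
    by rewrite addr_ge0// mulr_ge0//; nra.
  have [qm0|/ltW qm0] := leP (q * m) 0; first exact: le_trans k0.
  rewrite -(@ler_pXn2r _ 2)// ?nnegrE//.
  apply: (@le_trans _ _ ((d - 1) * u * (2 * (G * H)))).
    rewrite exprMn q2; apply: ler_pM => //; rewrite ?sqr_ge0 ?mulr_ge0//; try lra.
    by rewrite ler_wpM2r//; lra.
  (* With x and y the two factors after 4, the chain ends by 4xy <= (x + y)^2 <= (x + uG + y)^2; the
     present comparison needs 8d(2d - 1) >= 2. *)
  apply: (@le_trans _ _ (4 * (2 * (d - 1) * d * G) * ((2 * d - 1) * u * H))).
    rewrite -subr_ge0.
    rewrite (_ : _ - _ = (d - 1) * u * (G * H) * (8 * d * (2 * d - 1) - 2)); last by ring.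
    by rewrite !mulr_ge0//; nra.
  have uG : 0 <= u * G by rewrite mulr_ge0.
  have xG : 0 <= 2 * (d - 1) * d * G by rewrite !mulr_ge0//; lra.
  have yH : 0 <= (2 * d - 1) * u * H by rewrite !mulr_ge0//; lra.
  rewrite [(_ + u) * G]mulrDl; move: xG yH uG.
  move: (2 * (d - 1) * d * G) ((2 * d - 1) * u * H) (u * G) => x y z x0 y0 z0.
  apply: (@le_trans _ _ ((x + y) ^+ 2)); first by have := sqr_ge0 (x - y); lra.
  have xy0 := addr_ge0 x0 y0; have xzy0 := addr_ge0 (addr_ge0 x0 z0) y0.
  by rewrite ler_pXn2r ?nnegrE// lerD2r lerDl.
rewrite -subr_ge0 -/q; move: qm; rewrite -subr_ge0 /m /G /H.
by congr (0 <= _); ring.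
Qed.

(** Integrating [form_le] for s = 1 and s = -1 controls both signs of Im z. The scalar summands
    contribute 2(1 - d)|a|^2 <= 0, and the unit norm distributes p over the four summands. *)
Lemma numerical_range_cone z : 1 < d -> W z -> Re z + `|Im z| <= p.
Proof.
move=> d1 [[[[a b] g] h] n1 <-].
have rg := represents_refl g; have rh := represents_refl h.
move: rg rh.
move: (Re g : R -> R) (Im g : R -> R) (Re h : R -> R) (Im h : R -> R).
move=> gr gi hr hi rg rh.
have p0 := apex_gt0 d1.
have : Re (dsum_ip (a, b, g, h) (a, b, g, h)) = 1.
  move: n1; rewrite /= /hnorm => n1.
  have : 0 < Re (dsum_ip (a, b, g, h) (a, b, g, h)) by rewrite -sqrtr_gt0 n1.
  by move=> /ltW/sqr_sqrtr <-; rewrite n1 expr1n.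
rewrite (dsum_ip_represents _ _ _ _ _ _ _ _ rg rh).
rewrite (S_op_represents _ _ _ _ _ _ _ _ rg rh) /=.
have L2M (f f' : R -> R) : f \in Lfun mu 2%:E -> f' \in Lfun mu 2%:E ->
  (fun t => f t * f' t) \in Lfun mu 1 by exact: Lfun2_mul_Lfun1.
have [r11 r12 _ _] := represents_mul _ _ (entry11_continuous (d:=d)) _ _ rg.
have [r21 r22 _ _] := represents_mul _ _ (entry12_continuous (d:=d)) _ _ rh.
have [r31 r32 _ _] := represents_mul _ _ (entry22_continuous (d:=d)) _ _ rh.
have [Lgr Lgi _ _] := rg; have [Lhr Lhi _ _] := rh.
have ur := (Lfun_addr_closed mu (lee1n 2)).2 _ _ r11 r21.
have ui := (Lfun_addr_closed mu (lee1n 2)).2 _ _ r12 r22.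
have LA := Lfun1D _ _ _ (L2M _ _ Lgr Lgr) (L2M _ _ Lgi Lgi).
have LB := Lfun1D _ _ _ (L2M _ _ Lhr Lhr) (L2M _ _ Lhi Lhi).
have LX := Lfun1D _ _ _ (L2M _ _ ur Lgr) (L2M _ _ ui Lgi).
have LY := Lfun1D _ _ _ (L2M _ _ r31 Lhr) (L2M _ _ r32 Lhi).
have LZ : (fun t => (e11 t * gi t + e12 t * hi t) * gr t -
                    (e11 t * gr t + e12 t * hr t) * gi t) \in Lfun mu 1.
  rewrite (_ : (fun _ => _) = fun t => (e11 t * gi t + e12 t * hi t) * gr t +
      (-1) * ((e11 t * gr t + e12 t * hr t) * gi t)).
    exact: Lfun1D _ _ _ (L2M _ _ ui Lgr) (Lfun1Z _ (-1) _ (L2M _ _ ur Lgi)).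
  by apply/funext => t; rewrite mulN1r.
set A := \int[mu]_t (gr t * gr t + _).
set B := \int[mu]_t (hr t * hr t + _).
set X := \int[mu]_t (_ * gr t + _).
set Y := \int[mu]_t (_ * hr t + _).
set Z := \int[mu]_t (_ - _).
have key s : s ^+ 2 = 1 -> X + Y + s * Z <= p * A + p * B.
  move=> s1; rewrite /X /Y /Z /A /B.
  rewrite -!Rintegral_Lfun1Z// -!Rintegral_Lfun1D//.
  - apply: le_Rintegral => //.
    + by apply/Lfun1_integrable/Lfun1D; [exact: Lfun1D|exact: Lfun1Z].
    + by apply/Lfun1_integrable/Lfun1D; exact: Lfun1Z.
    + by move=> t _; exact: form_le.
  - exact: Lfun1Z.
  - exact: Lfun1Z.
  - exact: Lfun1D.
  - exact: Lfun1Z.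
have na : 0 <= Re a ^+ 2 + Im a ^+ 2 by rewrite addr_ge0 ?sqr_ge0.
have nb : 0 <= Re b ^+ 2 + Im b ^+ 2 by rewrite addr_ge0 ?sqr_ge0.
move: (Re a ^+ 2 + _) (Re b ^+ 2 + _) na nb => na nb na0 nb0 n1'.
have -> : p = p * na + p * nb + (p * A + p * B).
  by rewrite -[LHS]mulr1 -n1'; ring.
have pna : 0 <= p * na by rewrite mulr_ge0// ltW.
have pnb : 0 <= p * nb by rewrite mulr_ge0// ltW.
have dna : 0 <= (d - 1) * na by rewrite mulr_ge0 // subr_ge0 ltW.
have := key 1 (expr1n _ _); have := key (-1) (sqrr_sign _ 1).
by case: (ger0P Z) => _ k1 k2;
  move: dna pna pnb k1 k2; clear; lra.
Qed.

(** * Explicit points obtained from indicator vectors *)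

Lemma leb1d_itv (l m : R) : 1 <= l -> l <= m -> m <= d -> mu `[l, m]%classic = (m - l)%:E.
Proof.
move=> l1 lm md.
rewrite -[LHS]/(lebesgue_measure (`[l, m]%classic `&` `[1, d]%classic)).
rewrite setIidl; last first.
  move=> t /=; rewrite !in_itv /= => /andP[lt tm].
  by rewrite (le_trans l1 lt) (le_trans tm md).
rewrite lebesgue_measure_itv /= lte_fin; case: ltgtP lm => // -> _.
by rewrite subrr.
Qed.

(** The test vector is (a, b, x 1_J, i y 1_J) with J = [l, m]. The factor i sends the whole
    off-diagonal contribution to the imaginary part. *)
Lemma numerical_range_indic (l m a b x y : R) : 1 <= l -> l <= m -> m <= d ->
  a ^+ 2 + b ^+ 2 + (x ^+ 2 + y ^+ 2) * (m - l) = 1 ->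
  W ((2 * (1 - d) * a ^+ 2 +
      x ^+ 2 * (\int[mu]_t (e11 t * \1_(`[l, m]%classic) t)) +
      y ^+ 2 * (\int[mu]_t (e22 t * \1_(`[l, m]%classic) t))) +i*
     (x * y * \int[mu]_t (e12 t * \1_(`[l, m]%classic) t))).
Proof.
move=> l1 lm md n1; set J := `[l, m]%classic.
have mJ : measurable (J : set (measurableTypeR R)) by exact: measurable_itv.
have muJ : mu J = (m - l)%:E by exact: leb1d_itv.
have LJ : \1_J \in Lfun mu 2%:E by apply: indic_Lfun2; rewrite // muJ ltry.
have J2 t : \1_J t * \1_J t = \1_J t :> R.
  by rewrite indicE; case: (_ \in _); rewrite ?mulr1 ?mulr0.
have LZ z : (fun t => \1_J t * z) \in Lfun mu 2%:E.
  by apply: (@Lfun_scale _ _ _ mu \1_J z 2) => //; exact: ler1n.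
have Le (phi : R -> R) : {within `[1, d], continuous phi} ->
    (fun t => phi \_ `[1, d] t * \1_J t) \in Lfun mu 1.
  move=> cphi; have [L _ _ _] := represents_mul _ _ cphi _ _ 
    (represents_class _ _ LJ LJ).
  rewrite (_ : (fun _ => _) = ((phi \_ `[1, d]) \* \1_J) \* \1_J).
    exact: Lfun2_mul_Lfun1.
  by apply/funext => t /=; rewrite -mulrA J2.
have rg := represents_class _ _ (LZ x) (LZ 0).
have rh := represents_class _ _ (LZ 0) (LZ y).
exists (a%:C, b%:C, L2_class (LZ x) +i* L2_class (LZ 0),
        L2_class (LZ 0) +i* L2_class (LZ y)).
  rewrite /= /hnorm (dsum_ip_represents _ _ _ _ _ _ _ _ rg rh) /=.
  have I2 (u v : R) : \int[mu]_t (\1_J t * u * (\1_J t * u) +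
      \1_J t * v * (\1_J t * v)) = (u ^+ 2 + v ^+ 2) * (m - l).
    rewrite (_ : (fun _ => _) = fun t => (u ^+ 2 + v ^+ 2) * \1_J t).
      rewrite RintegralZl//; last first.
        apply/(Lfun1_integrable mu); rewrite (_ : \1_J = \1_J \* \1_J).
          exact: Lfun2_mul_Lfun1.
        by apply/funext => t /=; rewrite J2.
      by rewrite Rintegral_indic// muJ.
    by apply/funext => t; rewrite -[in RHS]J2; ring.
  rewrite !I2 (_ : _ + _ + _ + _ = 1) ?sqrtr1//.
  by rewrite -n1; ring.
rewrite (S_op_represents _ _ _ _ _ _ _ _ rg rh) /=.
have EI (k : R) (phi F : R -> R) : {within `[1, d], continuous phi} ->
    (forall t, F t = k * (phi \_ `[1, d] t * \1_J t)) ->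
    \int[mu]_t F t = k * \int[mu]_t (phi \_ `[1, d] t * \1_J t).
  move=> cphi FE; rewrite -(Rintegral_Lfun1Z _ _ _ (Le _ cphi)).
  by apply: eq_Rintegral => t _.
congr (_ +i* _); [congr (_ + _ + _)|].
- by ring.
- apply: (EI _ _ _ (entry11_continuous (d:=d))) => t.
  by rewrite -[in RHS]J2; ring.
- apply: (EI _ _ _ (entry22_continuous (d:=d))) => t.
  by rewrite -[in RHS]J2; ring.
- apply: (EI _ _ _ (entry12_continuous (d:=d))) => t.
  by rewrite -[in RHS]J2; ring.
Qed.

Lemma Rintegral_patch_indic_ge (phi : R -> R) (l m k : R) :
  {within `[1, d], continuous phi} -> 1 <= l -> l <= m -> m <= d ->
  (forall t, l <= t <= m -> k <= phi t) ->
  k * (m - l) <= \int[mu]_t (phi \_ `[1, d] t * \1_(`[l, m]%classic) t).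
Proof.
move=> cphi l1 lm md kphi; set J := `[l, m]%classic.
have mJ : measurable (J : set (measurableTypeR R)) by exact: measurable_itv.
have muJ : mu J = (m - l)%:E by exact: leb1d_itv.
have LJ : \1_J \in Lfun mu 2%:E by apply: indic_Lfun2; rewrite // muJ ltry.
rewrite -[m - l]/(fine (m - l)%:E) -muJ; apply: Rintegral_indic_ge => //.
- by rewrite muJ ltry.
- have [Lphi _ _ _] := represents_mul _ _ cphi _ _
    (represents_class _ _ LJ LJ).
  rewrite (_ : _ \* _ = ((phi \_ `[1, d]) \* \1_J) \* \1_J).
    exact: Lfun2_mul_Lfun1.
  apply/funext => t /=; rewrite -mulrA indicE.
  by case: (_ \in _); rewrite ?mulr1 ?mulr0.
move=> t; rewrite /J /= in_itv /= => tlm; rewrite patchE mem_set ?kphi//=.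
by case/andP: tlm => lt tm; rewrite in_itv /= (le_trans l1) ?(le_trans tm).
Qed.

Lemma apex_closure : 1 < d -> closure_Ri W p%:C.
Proof.
move=> d1; apply/closure_RiP => e e0.
have k0 : 0 < 2 * d - 1 by lra.
(* The first bound keeps [d - w, d] inside [1, d]; the second makes [entry22] vary by at most e / 2
   there. *)
pose w := Num.min (d - 1) (e / (2 * (2 * d - 1))).
have w0 : 0 < w by rewrite /w lt_min subr_gt0 d1 divr_gt0// mulr_gt0.
have wd : w <= d - 1 by rewrite /w ge_min lexx.
have we : (2 * d - 1) * w < e.
  apply: (@le_lt_trans _ _ ((2 * d - 1) * (e / (2 * (2 * d - 1))))).
    by rewrite ler_wpM2l ?(ltW k0)// /w ge_min lexx orbT.
  rewrite (_ : _ * _ = e / 2); first by lra.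
  by field; rewrite gt_eqF.
have l1 : 1 <= d - w by lra.
have ld : d - w <= d by lra.
pose y := Num.sqrt w^-1.
have y2 : y ^+ 2 * (d - (d - w)) = 1.
  by rewrite sqr_sqrtr ?invr_ge0 ?ltW// subKr mulVf// gt_eqF.
have Wz := numerical_range_indic (d - w) d 0 0 0 y l1 ld (lexx _).
have {}Wz := Wz _; rewrite !expr0n /= !add0r !mulr0 !mul0r !add0r in Wz.
have {}Wz := Wz y2.
eexists; first exact: Wz.
have := Rintegral_patch_indic_ge _ _ _ ((2 * d - 1) * (d - w - 1))
  (entry22_continuous (d:=d)) l1 ld (lexx _).
(* The cone bound gives y^2 I <= p, so the distance to p is p - y^2 I and only a lower bound on I
   remains to be used. *)
have := numerical_range_cone _ d1 Wz.
set I := \int[mu]_t _ => /=; rewrite normr0 addr0 => yIp Ige.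
have {}Ige : (2 * d - 1) * (d - w - 1) <= y ^+ 2 * I.
  set k := _ * _ in Ige *; have -> : k = y ^+ 2 * (k * (d - (d - w))).
    by rewrite mulrCA y2 mulr1.
  rewrite ler_wpM2l ?sqr_ge0//.
  apply: Ige => t /andP[dt _]; rewrite /k /entry22 /D0 /I0 /=.
  by rewrite ler_wpM2l ?(ltW k0)//; lra.
rewrite subrr expr0n addr0 sqrtr_sqr ger0_norm; last by lra.
by apply: le_lt_trans we; rewrite /apex; lra.
Qed.

Lemma numerical_range_nonreal : 1 < d -> exists2 z, W z & Im z != 0.
Proof.
move=> d1; pose c := d - 1; have c0 : 0 < c by rewrite /c; lra.
(* On [l, m] both t - 1 and d - t are at least c / 4, hence so is [entry12]; [x] below normalises
   the vector. *)
pose l := 1 + c / 4; pose m := 1 + c / 2.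
have l1 : 1 <= l by rewrite /l; lra.
have lm : l < m by rewrite /l /m; lra.
have md : m <= d by rewrite /m /c; lra.
pose x := Num.sqrt ((2 * (m - l))^-1).
have ml0 : 0 < m - l by lra.
have x0 : 0 < x by rewrite sqrtr_gt0 invr_gt0 mulr_gt0.
have n1 : 0 ^+ 2 + 0 ^+ 2 + (x ^+ 2 + x ^+ 2) * (m - l) = 1.
  rewrite sqr_sqrtr; last by rewrite invr_ge0 mulr_ge0// ltW.
  by field; rewrite gt_eqF.
have Wz := numerical_range_indic l m 0 0 x x l1 (ltW lm) md n1.
eexists; first exact: Wz.
rewrite /= gt_eqF// !mulr_gt0//.
apply: lt_le_trans (Rintegral_patch_indic_ge _ l m (c / 4)
  (entry12_continuous (d:=d)) l1 (ltW lm) md _).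
  by rewrite !mulr_gt0//; lra.
move=> t /andP[lt tm]; rewrite /entry12 /D0 /I0 /= mulr1.
have q0 : 0 <= c / 4 by lra.
rewrite -(ger0_norm q0) -sqrtr_sqr expr2 sqrtrM//.
apply: ler_pM; rewrite ?sqrtr_ge0// ler_wsqrtr//.
  by move: lt; rewrite /l; lra.
by move: tm; rewrite /m /c; lra.
Qed.

Lemma numerical_range_real_points : 1 < d -> W 0 /\ W (2 * (1 - d))%:C.
Proof.
move=> d1; split.
  (* With x = y = 0 only the scalar summands remain, and [1, 1] merely fills the place of the
     interval. *)
  have := numerical_range_indic 1 1 0 1 0 0 (lexx _) (lexx _) (ltW d1).
  rewrite !expr0n /= !mul0r !mulr0 !addr0 expr1n add0r mul0r addr0; exact.
have := numerical_range_indic 1 1 1 0 0 0 (lexx _) (lexx _) (ltW d1).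
rewrite !expr0n /= !mul0r !addr0 !expr1n mul0r addr0 mulr1; exact.
Qed.

End NumericalRangeSr.

Theorem theorem4p16 (R : realType) (r : R) (hr : 1 < r) :
  let d : R := 2^-1 * (r + 1) in
  ~ elliptical_disk (closure_Ri (numerical_range (@dsum_ip R d) (@S_op R d))).
Proof.
move=> d; have d1 : 1 < d by rewrite /d; lra.
have [W0 Wq] := numerical_range_real_points d d1.
have [z Wz z0] := numerical_range_nonreal d d1.
apply: (corner_not_elliptical _ _ _ _ _ (apex_closure d d1) W0 Wq _ Wz z0).
  by move=> w; exact: numerical_range_cone.
by rewrite mulf_neq0// subr_eq0 lt_eqF.
Qed.
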